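(* Let $Z,Y$ be Asplund spaces, $f:Z\to Y$ locally Lipschitz, $K\subset Y$ a pointed closed convex cone, $\mathcal{U}$ a sequentially compact topological space, and $g=(g_1,\dots,g_n)$ with $g_i:Z\times\mathcal{U}\to\mathbb{R}$. Let $(f,g)$ be type I pseudo convex at $\bar z\in F$. Assume that there exist $y^*\in\mathrm{int}\,K^+$, $\mu=(\mu_1,\dots,\mu_n)\in\mathbb{R}^n_+$ and $\bar u_i\in\mathcal{U}$, $i=1,\dots,n$, such that $$0\in\partial\langle y^*,f\rangle(\bar z)+\sum_{i=1}^n\mu_i\,\mathrm{cl}^*\mathrm{co}\Big(\bigcup\big\{\partial_z g_i(\bar z,u)\mid u\in\mathcal{U}_i(\bar z)\big\}\Big),$$ $$\mu_i\max_{u\in\mathcal{U}}g_i(\bar z,u)=\mu_i\,g_i(\bar z,\bar u_i)=0,\quad i=1,\dots,n.$$ Then $\bar z\in\mathcal{S}^{pr}(RP)$ (i.e. $\bar z$ is a properly robust efficient solution).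
   Context: Notation. $Z^*,Y^*$ are the topological duals; $\mathrm{cl}^*$ is weak$^*$ closure, $\mathrm{co}$ convex hull, $\mathrm{int}$ topological (norm) interior. $K$ pointed means $K\cap(-K)=\{0\}$. The dual cone is $K^+=\{y^*\in Y^*\mid \langle y^*,y\rangle\ge 0\ \forall y\in K\}$, and $\mathrm{int}\,K^+$ is the interior of $K^+$. $\langle y^*,f\rangle(z):=\langle y^*,f(z)\rangle$. $\mathbb{R}^n_+$ is the nonnegative orthant. Robust problem. The feasible set is $F=\{z\in Z\mid g_i(z,u)\le 0\ \forall u\in\mathcal{U},\ i=1,\dots,n\}$. $\bar z\in\mathcal{S}^{pr}(RP)$ means $\bar z\in F$ and there exists $y^*\in\mathrm{int}\,K^+$ such that $\langle y^*,f(z)-f(\bar z)\rangle\ge 0$ for all $z\in F$. $\mathcal{U}_i(z):=\{u\in\mathcal{U}\mid g_i(z,u)=\max_{u'\in\mathcal{U}}g_i(z,u')\}$. Generalized convexity. - $f$ is pseudo convex at $\bar z$ if for all $z\in Z$, $y^*\in K^+$: $\langle y^*,f\rangle(z)<\langle y^*,f\rangle(\bar z)$ implies $\langle v^*,z-\bar z\rangle<0$ for all $v^*\in\partial\langle y^*,f\rangle(\bar z)$. - $g$ is generalized quasi convex at $\bar z$ if for all $z\in Z$, $u\in\mathcal{U}$ and $i=1,\dots,n$: $g_i(z,u)\le g_i(\bar z,u)$ implies $\langle u_i^*,z-\bar z\rangle\le 0$ for all $u_i^*\in\partial_z g_i(\bar z,u)$. - $(f,g)$ is type I pseudo convex at $\bar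 z$ if $f$ is pseudo convex and $g$ is generalized quasi convex at $\bar z$. Subdifferential. For $\Gamma$ locally closed around $\bar x\in\Gamma$: the Fréchet normal cone is $\widehat N(\bar x;\Gamma)=\{x^*\mid\limsup_{x\to\bar x,\,x\in\Gamma}\langle x^*,x-\bar x\rangle/\|x-\bar x\|\le 0\}$, and the Mordukhovich normal cone $N(\bar x;\Gamma)$ is the set of $x^*$ for which there are sequences $x_k\to\bar x$, $x_k\in\Gamma$, and $x_k^*\in\widehat N(x_k;\Gamma)$ with $x_k^*\to x^*$ weak$^*$. The limiting (Mordukhovich) subdifferential of $\varphi:Z\to\overline{\mathbb{R}}$ at $\bar z$ with $\varphi(\bar z)$ finite is $\partial\varphi(\bar z)=\{z^*\in Z^*\mid(z^*,-1)\in N((\bar z,\varphi(\bar z));\mathrm{epi}\,\varphi)\}$. $\partial_z g_i(z,u)$ is the limiting subdifferential of $g_i(\cdot,u)$ at $z$. *)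

(* Defs.v *)
From HB Require Import structures.
From mathcomp Require Import all_boot all_order all_algebra.
From mathcomp Require Import all_classical all_reals all_analysis.

Set Implicit Arguments.
Unset Strict Implicit.
Unset Printing Implicit Defensive.

Import Order.TTheory GRing.Theory Num.Theory.
Import numFieldNormedType.Exports.

Local Open Scope classical_set_scope.
Local Open Scope ring_scope.

Section dual_def.
Context {R : realType} (X : normedModType R).

Definition dual_pred : {pred X -> R^o} :=
  mem [set f : X -> R^o | linear f /\ continuous f].

Record dual : Type := Dual {
  dual_fun :> X -> R^o ;
  dual_funP : dual_fun \in dual_pred }.

HB.instance Definition _ := [isSub for dual_fun].
HB.instance Definition _ := [Choice of dual by <:].

Lemma dual_linear (f : dual) : linear f.
Proof. by have := dual_funP f; rewrite !inE => -[]. Qed.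

Lemma dual_continuous (f : dual) : continuous f.
Proof. by have := dual_funP f; rewrite !inE => -[]. Qed.

HB.instance Definition _ (f : dual) :=
  GRing.isLinear.Build R X R^o _ (dual_fun f) (dual_linear f).

Lemma dual_submod_closed : submod_closed dual_pred.
Proof.
split; first by rewrite !inE; split;
  [move=> a x y; rewrite scaler0 addr0|exact: cst_continuous].
move=> a f g; rewrite !inE => -[lf cf] [lg cg]; split.
  move=> b x y; rewrite !addrfctE !scalrfctE lf lg !scalerDr !scalerA.
  by rewrite (mulrC a b) addrACA.
move=> x; apply: cvgD; last exact: cg.
by apply: cvgZr; exact: cf.
Qed.

HB.instance Definition _ :=
  GRing.isSubmodClosed.Build _ _ dual_pred dual_submod_closed.
HB.instance Definition _ := [SubChoice_isSubLmodule of dual by <:].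

Definition dual_norm (f : dual) : R :=
  sup [set `|f x| | x in [set x : X | `|x| <= 1]].

Lemma dual_has_sup (f : dual) :
  has_sup [set `|f x| | x in [set x : X | `|x| <= 1]].
Proof.
split; first by exists `|f 0|, 0 => //=; rewrite normr0.
have /linear_bounded_continuous/bounded_funP := @dual_continuous f.
by move=> /(_ 1)[M fM]; exists M => _ [x /= x1 <-]; exact: fM.
Qed.

Lemma dual_norm_ub (f : dual) (x : X) : `|x| <= 1 -> `|f x| <= dual_norm f.
Proof.
by move=> x1; apply: sup_upper_bound; [exact: dual_has_sup|exists x].
Qed.

Lemma dual_norm_le (f : dual) (M : R) :
  (forall x, `|x| <= 1 -> `|f x| <= M) -> dual_norm f <= M.
Proof.
move=> fM; apply: ge_sup; first by have [] := dual_has_sup f.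
by move=> _ [x /= x1 <-]; exact: fM.
Qed.

Lemma dual_norm_ge0 (f : dual) : 0 <= dual_norm f.
Proof.
by apply: (le_trans (normr_ge0 (f 0))); apply: dual_norm_ub; rewrite normr0.
Qed.

Lemma dual_normP (f : dual) (x : X) : `|f x| <= dual_norm f * `|x|.
Proof.
have [->|x0] := eqVneq x 0; first by rewrite linear0 !normr0 mulr0.
have nx : 0 < `|x| by rewrite normr_gt0.
rewrite -ler_pdivrMr// mulrC -[X in X * _]ger0_norm ?invr_ge0//.
rewrite -normrZ -linearZ; apply: dual_norm_ub.
by rewrite normrZ normfV normr_id mulVf ?gt_eqF.
Qed.

Lemma dual_normD (f g : dual) : dual_norm (f + g) <= dual_norm f + dual_norm g.
Proof.
apply: dual_norm_le => x x1; rewrite (le_trans (ler_normD _ _))//.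
by apply: lerD; exact: dual_norm_ub.
Qed.

Lemma dual_normZ (a : R) (f : dual) : dual_norm (a *: f) = `|a| * dual_norm f.
Proof.
have leZ b h : dual_norm (b *: h) <= `|b| * dual_norm h.
  apply: dual_norm_le => x x1; rewrite normrZ.
  by apply: ler_wpM2l => //; exact: dual_norm_ub.
apply/eqP; rewrite eq_le leZ/=.
have [->|a0] := eqVneq a 0; first by rewrite normr0 mul0r dual_norm_ge0.
rewrite -ler_pdivlMl ?normr_gt0// -normfV.
by apply: le_trans (leZ _ _); rewrite scalerA mulVf// scale1r.
Qed.

Lemma dual_norm0_eq0 (f : dual) : dual_norm f = 0 -> f = 0.
Proof.
move=> f0; apply/val_inj/funext => x /=; apply/normr0_eq0/le_anti.
by rewrite normr_ge0 andbT -(mul0r `|x|) -f0 dual_normP.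
Qed.

HB.instance Definition _ :=
  Lmodule_isNormed.Build R dual dual_normD dual_normZ dual_norm0_eq0.

Definition weak_star : Type :=
  initial_topology (dual_fun : dual -> {ptws X -> R^o}).

HB.instance Definition _ := Topological.copy weak_star
  (initial_topology (dual_fun : dual -> {ptws X -> R^o})).

Definition weak_star_closure (A : set dual) : set dual :=
  closure (A : set weak_star).

Definition weak_star_cvg (xs : nat -> dual) (x : dual) : Prop :=
  (xs : nat -> weak_star) @ \oo --> (x : weak_star).

End dual_def.

Arguments dual_pred {R} X.
Arguments dual {R} X.
Arguments weak_star {R} X.

(* the functional (x, r) |-> <xs, x> + a * r, written (xs, a) when the dual of
   X * R is identified with X^* * R *)
Section dual_pair.
Context {R : realType} {X : normedModType R}.

Definition dual_pair_fun (xs : dual X) (a : R) (p : X * R^o) : R^o :=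
  xs p.1 + a * p.2.

Lemma dual_pair_subproof (xs : dual X) (a : R) :
  dual_pair_fun xs a \in dual_pred (X * R^o)%type.
Proof.
rewrite !inE; split.
  move=> b [x r] [y s]; rewrite /dual_pair_fun/= linearP scalerDr addrACA.
  by congr (_ + _); rewrite /GRing.scale/= mulrDr mulrCA.
move=> p; apply: cvgD.
  by apply: (cvg_comp _ _ cvg_fst); exact: dual_continuous.
by apply: cvgM; [exact: cvg_cst|exact: cvg_snd].
Qed.

Definition dual_pair (xs : dual X) (a : R) : dual (X * R^o)%type :=
  Dual (dual_pair_subproof xs a).

End dual_pair.

(* the usual "dense G_delta set of points of Frechet differentiability" is the
   same requirement, the set of such points being always a G_delta *)
Definition asplund (R : realType) (X : completeNormedModType R) : Prop :=
  forall (D : set X) (phi : X -> R^o),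
    open D -> convex_set (D : set (convex_lmodType X)) ->
    convex_function (D : set (convex_lmodType X)) phi ->
    {in D, continuous phi} ->
    D `<=` closure [set x | D x /\ differentiable phi x].

Section subdifferential.
Context {R : realType} {X : normedModType R}.

(* [x^'] discards the base point, where the quotient is 0 / 0 *)
Definition frechet_normal (G : set X) (x : X) : set (dual X) :=
  [set xs : dual X |
    (limf_esup (fun y => (xs (y - x) / `|y - x|)%:E) (within G x^') <= 0)%E].

(* the formula is used whether or not G is locally closed around x *)
Definition limiting_normal (G : set X) (x : X) : set (dual X) :=
  [set xs : dual X | exists (x_ : nat -> X) (xs_ : nat -> dual X),
    [/\ x_ @ \oo --> x,
        forall k, G (x_ k),
        forall k, frechet_normal G (x_ k) (xs_ k) &
        weak_star_cvg xs_ xs] ].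

End subdifferential.

Section subdifferential_fun.
Context {R : realType} {X : normedModType R}.

Definition epigraph (phi : X -> \bar R) : set (X * R^o) :=
  [set p | (phi p.1 <= p.2%:E)%E].

Definition limiting_subdiff (phi : X -> \bar R) (x : X) : set (dual X) :=
  [set xs | phi x \is a fin_num /\
    limiting_normal (epigraph phi) (x, fine (phi x)) (dual_pair xs (-1))].

End subdifferential_fun.

Definition add_set (V : zmodType) (A B : set V) : set V :=
  [set a + b | a in A & b in B].

Definition sum_set (V : zmodType) (n : nat) (A : 'I_n -> set V) : set V :=
  [set \sum_(i < n) w i | w in [set w : 'I_n -> V | forall i, A i (w i)]].

Definition scale_set (R : realType) (V : lmodType R) (t : R) (A : set V)
  : set V := [set t *: a | a in A].

Definition convex_hull (R : realType) (V : lmodType R) (A : set V) : set V :=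
  smallest (@convex_set R V) A.

Definition is_max (R : realType) (A : set R) (m : R) : Prop :=
  A m /\ ubound A m.

Definition sequentially_compact (T : topologicalType) : Prop :=
  forall u : nat -> T, exists s : nat -> nat,
    {homo s : j k / (j < k)%N} /\ exists l : T, u \o s @ \oo --> l.

Definition is_cone (R : realType) (V : lmodType R) (K : set V) : Prop :=
  forall (t : R) (y : V), 0 <= t -> K y -> K (t *: y).

Definition pointed_cone (V : zmodType) (K : set V) : Prop :=
  K `&` [set - y | y in K] = [set 0].

Definition dual_cone (R : realType) (Y : normedModType R) (K : set Y)
  : set (dual Y) := [set ys : dual Y | forall y, K y -> 0 <= ys y].

Section robust.
Context {R : realType} {Z Y : normedModType R} {U : Type} {n : nat}.
Variables (K : set Y) (f : Z -> Y) (g : 'I_n -> Z -> U -> R).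

Definition feasible : set Z := [set z | forall u i, g i z u <= 0].

Definition properly_robust_efficient (zbar : Z) : Prop :=
  feasible zbar /\
  exists2 ys : dual Y, interior (dual_cone K) ys &
    forall z, feasible z -> 0 <= ys (f z - f zbar).

Definition active (i : 'I_n) (z : Z) : set U :=
  [set u | is_max (range (g i z)) (g i z u)].

Definition pseudo_convex (zbar : Z) : Prop :=
  forall (z : Z) (ys : dual Y), dual_cone K ys ->
    ys (f z) < ys (f zbar) ->
    forall vs, limiting_subdiff (fun z => (ys (f z))%:E) zbar vs ->
      vs (z - zbar) < 0.

Definition generalized_quasi_convex (zbar : Z) : Prop :=
  forall (z : Z) (u : U) (i : 'I_n),
    g i z u <= g i zbar u ->
    forall us, limiting_subdiff (fun z => (g i z u)%:E) zbar us ->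
      us (z - zbar) <= 0.

Definition type1_pseudo_convex (zbar : Z) : Prop :=
  pseudo_convex zbar /\ generalized_quasi_convex zbar.

End robust.

(* Main.v *)
Require Import Defs.
From mathcomp Require Import all_boot all_order all_algebra.
From mathcomp Require Import all_classical all_reals all_analysis.

Set Implicit Arguments.
Unset Strict Implicit.
Unset Printing Implicit Defensive.

Import Order.TTheory GRing.Theory Num.Theory.
Import numFieldNormedType.Exports.

Local Open Scope classical_set_scope.
Local Open Scope ring_scope.

(** Suppose that some feasible [z] had [ys (f z) < ys (f zbar)], and look at
    the direction [h = z - zbar].  Pseudo convexity makes every element of the
    subdifferential of [ys \o f] at [zbar] strictly negative at [h].  A
    constraint [i] with [mu i != 0] has maximal value 0 at [zbar] by
    complementary slackness, so [g i z u <= 0 = g i zbar u] for every active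
    [u], and quasi convexity puts all the active subgradients in the half-space
    of functionals that are nonpositive at [h].  That half-space is convex and
    weak-star closed ([weak_star_closure_convex_hull_le0]), hence it still
    contains the weak-star closed convex hull of these subgradients.  Evaluated
    at [h], the multiplier condition therefore writes 0 as the sum of a negative
    number and of nonpositive ones, which is absurd. *)

Section dual_evaluation.
Context {R : realType} {X : normedModType R}.
Implicit Types (h : X) (A : set (dual X)).

Lemma dual_sumE (n : nat) (w : 'I_n -> dual X) h :
  (\sum_(i < n) w i) h = \sum_(i < n) w i h.
Proof. exact: (big_morph (fun xs : dual X => xs h : R)). Qed.

Lemma weak_star_eval_continuous h :
  continuous (fun xs : weak_star X => (xs : dual X) h : R^o).
Proof.
move=> xs.
have incl_continuous : {for xs, continuous
    (@dual_fun R X : weak_star X -> {ptws X -> R^o})} by exact: initial_continuous.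
have eval_continuous : continuous (fun F : {ptws X -> R^o} => F h).
  exact: (@proj_continuous X (fun=> R^o) h).
exact: (continuous_comp incl_continuous (eval_continuous _)).
Qed.

Lemma convex_dual_le0 h : convex_set [set xs : dual X | xs h <= 0].
Proof.
move=> x y t; rewrite !inE /= => x0 y0.
rewrite -[leLHS]/(t%:num * x h + (1 - t%:num) * y h).
by rewrite -[leRHS]addr0 lerD// mulr_ge0_le0 ?subr_ge0.
Qed.

Lemma weak_star_closed_le0 h :
  closed ([set xs : dual X | xs h <= 0] : set (weak_star X)).
Proof.
have -> : [set xs : dual X | xs h <= 0] =
    (fun xs : weak_star X => (xs : dual X) h : R^o) @^-1` [set r | r <= 0].
  by [].
apply: closed_comp; last exact: closed_le.
by move=> xs _; exact: weak_star_eval_continuous.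
Qed.

(** Being a convex weak-star closed set, the half-space of functionals that are
    nonpositive at [h] absorbs both the hull and the closure. *)
Lemma weak_star_closure_convex_hull_le0 A h :
  (forall xs, A xs -> xs h <= 0) ->
  forall xs, weak_star_closure (convex_hull A) xs -> xs h <= 0.
Proof.
move=> A0 xs; rewrite /weak_star_closure closureE.
move: xs; apply: smallest_sub; first exact: weak_star_closed_le0.
by apply: smallest_sub => //; exact: convex_dual_le0.
Qed.

End dual_evaluation.

Theorem theorem3p6 (R : realType) (Z Y : completeNormedModType R)
    (U : topologicalType) (n : nat) (f : Z -> Y) (K : set Y)
    (g : 'I_n -> Z -> U -> R) (zbar : Z) :
  asplund Z -> asplund Y ->
  [locally [lipschitz f z | z in setT]] ->
  pointed_cone K -> closed K -> is_cone K -> @convex_set R Y K ->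
  sequentially_compact U ->
  feasible g zbar ->
  type1_pseudo_convex K f g zbar ->
  (exists (ys : dual Y) (mu : 'I_n -> R) (ubar : 'I_n -> U),
    [/\ interior (dual_cone K) ys,
        forall i, 0 <= mu i,
        add_set
          (limiting_subdiff (fun z => (ys (f z))%:E) zbar)
          (sum_set (fun i => scale_set (mu i)
             (weak_star_closure (convex_hull
               (\bigcup_(u in active g i zbar)
                  limiting_subdiff (fun z => (g i z u)%:E) zbar))))) 0 &
        forall i, exists m, [/\ is_max (range (g i zbar)) m,
          mu i * m = mu i * g i zbar (ubar i) &
          mu i * g i zbar (ubar i) = 0] ]) ->
  properly_robust_efficient K f g zbar.
Proof.
move=> _ _ _ _ _ _ _ _ zbarF [fpc gqc] [ys [mu [ubar [ysK mu0 sum0 slack]]]].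
split=> //; exists ys => // z zF.
rewrite linearB subr_ge0 leNgt; apply/negP => yfz.
have [vs fvs [_ [w wA <-]] vsw0] := sum0.
have vs_lt0 : vs (z - zbar) < 0.
  by apply: fpc fvs => //; exact: interior_subset ysK.
have w_le0 i : w i (z - zbar) <= 0.
  have [a aA <-] := wA i.
  rewrite -[leLHS]/(mu i * a (z - zbar)).
  have [->|mui0] := eqVneq (mu i) 0; first by rewrite mul0r.
  rewrite mulr_ge0_le0//; apply: weak_star_closure_convex_hull_le0 aA => us.
  move=> [u [_ umax] gus]; apply: gqc gus.
  have [m [[[v _ <-] _] mE mubar0]] := slack i.
  have /eqP gv0 : g i zbar v == 0.
    by move/eqP: mE; rewrite mubar0 mulf_eq0 (negbTE mui0).
  (* [u] attains the maximum, which is the value 0 attained at [v] *)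
  apply: le_trans (zF u i) _; rewrite -gv0; apply: umax; exact: imageT.
have : vs (z - zbar) + \sum_(i < n) w i (z - zbar) = 0.
  rewrite -dual_sumE.
  by have := congr1 (fun xs : dual Z => xs (z - zbar)) vsw0.
by apply/eqP; rewrite lt_eqF// ltr_wnDr// sumr_le0.
Qed.
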